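(* Let $m\ge n$ and let $A\in\mathbb{R}^{m\times m}$, $B\in\mathbb{R}^{n\times n}$ have no common eigenvalue. Let $C\in\mathbb{R}^{m\times n}$, and suppose that the unique solution $X\in\mathbb{R}^{m\times n}$ of the Sylvester equation $AX-XB=C$ has full rank. Then $$\kappa_2(X)\ge\frac{\|C\|_2}{\|A\|_2+\|B\|_2}\cdot\frac{\operatorname{sep}(A,B)}{\|C\|_F}\ge\frac{\operatorname{sep}(A,B)}{\sqrt{\operatorname{rank}C}\,\bigl(\|A\|_2+\|B\|_2\bigr)}.$$
   Context: The separation is $\operatorname{sep}(A,B)=\min_{Y\ne0}\frac{\|AY-YB\|_F}{\|Y\|_F}$, the minimum being over nonzero $Y\in\mathbb{R}^{m\times n}$. For a nonzero matrix $X$ of rank $r$, $\kappa_2(X)=\|X\|_2\|X^{+}\|_2=\sigma_1(X)/\sigma_r(X)$, where $X^+$ is the Moore--Penrose pseudoinverse. $\|\cdot\|_2$ is the spectral norm and $\|\cdot\|_F$ the Frobenius norm. *)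

(* Defs.v *)
From HB Require Import structures.
From mathcomp Require Import all_boot all_order all_algebra.
From mathcomp Require Import all_classical all_reals all_analysis.
From mathcomp Require Import complex.

Set Implicit Arguments.
Unset Strict Implicit.
Unset Printing Implicit Defensive.

Import Order.TTheory GRing.Theory Num.Theory.
Import numFieldNormedType.Exports.
Local Open Scope classical_set_scope.
Local Open Scope ring_scope.

Definition normF (R : realType) (m n : nat) (A : 'M[R]_(m, n)) : R :=
  Num.sqrt (\sum_i \sum_j A i j ^+ 2).

(* On column vectors [normF] is the Euclidean norm, so this is the operator
   norm induced by the Euclidean norms; the supremum is attained when [n] is
   positive: see [norm2_max]. *)
Definition norm2 (R : realType) (m n : nat) (A : 'M[R]_(m, n)) : R :=
  sup [set normF (A *m x) / normF x | x in [set x : 'cV[R]_n | x != 0]].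

(* The infimum is a minimum when [m] and [n] are positive: see [sep_min]. *)
Definition sep (R : realType) (m n : nat) (A : 'M[R]_m) (B : 'M[R]_n) : R :=
  inf [set normF (A *m Y - Y *m B) / normF Y
      | Y in [set Y : 'M[R]_(m, n) | Y != 0]].

Definition is_pinv (R : realType) (m n : nat)
    (X : 'M[R]_(m, n)) (P : 'M[R]_(n, m)) : Prop :=
  [/\ X *m P *m X = X, P *m X *m P = P,
      (X *m P)^T = X *m P & (P *m X)^T = P *m X].

(* The matrix satisfying the Penrose conditions exists and is unique
   ([is_pinv_exists], [is_pinv_inj]). MathComp's [pinvmx] is only a
   generalized inverse, not the Moore-Penrose one. *)
Definition mp_pinv (R : realType) (m n : nat) (X : 'M[R]_(m, n)) :
    'M[R]_(n, m) :=
  xget 0 [set P | is_pinv X P].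

Definition kappa2 (R : realType) (m n : nat) (X : 'M[R]_(m, n)) : R :=
  norm2 X * norm2 (mp_pinv X).

(* Eigenvalues of a real matrix are taken in the complex numbers. *)
Definition complex_eigenvalue (R : realType) (n : nat) (A : 'M[R]_n)
    (z : R[i]) : bool :=
  eigenvalue (map_mx (real_complex R) A) z.

Lemma is_pinv_inj (R : realType) (m n : nat) (X : 'M[R]_(m, n))
    (P Q : 'M[R]_(n, m)) :
  is_pinv X P -> is_pinv X Q -> P = Q.
Proof.
move=> [p1 p2 p3 p4] [q1 q2 q3 q4].
have eXP : X *m P = X *m Q.
  rewrite -p3 -{1}q1 -(mulmxA _ X P) trmx_mul p3 q3.
  by rewrite mulmxA p1.
have ePX : P *m X = Q *m X.
  rewrite -p4 -{1}q1 -!mulmxA (mulmxA P) trmx_mul p4 q4.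
  by rewrite -mulmxA (mulmxA X) p1.
by rewrite -p2 ePX -mulmxA eXP mulmxA q2.
Qed.

Lemma normF_ge0 (R : realType) (m n : nat) (A : 'M[R]_(m, n)) : 0 <= normF A.
Proof. exact: sqrtr_ge0. Qed.

Lemma normF_eq0 (R : realType) (m n : nat) (A : 'M[R]_(m, n)) :
  (normF A == 0) = (A == 0).
Proof.
have s0 i : 0 <= \sum_j A i j ^+ 2 by apply: sumr_ge0 => j _; exact: sqr_ge0.
apply/idP/eqP => [|->]; last first.
  rewrite /normF big1 ?sqrtr0// => i _; rewrite big1// => j _.
  by rewrite mxE expr0n.
rewrite sqrtr_eq0 => h.
have /eqP : \sum_i \sum_j A i j ^+ 2 = 0.
  by apply/eqP; rewrite eq_le h sumr_ge0.
rewrite psumr_eq0// => /allP h1; apply/matrixP => i j.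
have := h1 i (mem_index_enum _); rewrite /= psumr_eq0; last first.
  by move=> k _; exact: sqr_ge0.
by move=> /allP /(_ j (mem_index_enum _)) /=; rewrite sqrf_eq0 mxE => /eqP.
Qed.

Lemma mulmx_tr_eq0 (R : realType) (n : nat) (u : 'rV[R]_n) :
  u *m u^T = 0 -> u = 0.
Proof.
move=> /matrixP /(_ 0 0); rewrite !mxE => h.
apply/eqP; rewrite -normF_eq0 /normF big_ord1.
rewrite (_ : \sum_j _ = 0) ?sqrtr0//.
by rewrite -{}[RHS]h; apply: eq_bigr => j _; rewrite mxE expr2.
Qed.

Lemma gram_unitmx (R : realType) (k p : nat) (M : 'M[R]_(k, p)) :
  row_free M -> M *m M^T \in unitmx.
Proof.
move=> fM; rewrite -row_free_unit -kermx_eq0.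
apply/eqP/row_matrixP => i; rewrite row0.
have h : row i (kermx (M *m M^T)) *m (M *m M^T) = 0.
  by rewrite -row_mul mulmx_ker row0.
move: (row i _) h => u h.
have : u *m M = 0.
  apply: mulmx_tr_eq0; rewrite trmx_mul mulmxA -(mulmxA u M).
  by rewrite h mul0mx.
by move=> /eqP; rewrite mulmx_free_eq0// => /eqP.
Qed.

Lemma is_pinv_exists (R : realType) (m n : nat) (X : 'M[R]_(m, n)) :
  exists P, is_pinv X P.
Proof.
have [r [L [S [XE fL fS]]]] : exists r (L : 'M[R]_(m, r)) (S : 'M[R]_(r, n)),
    [/\ X = L *m S, row_full L & row_free S].
  exists (\rank X), (col_base X), (row_base X).
  by rewrite mulmx_base col_base_full row_base_free.
have uS : S *m S^T \in unitmx by exact: gram_unitmx.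
have uL : L^T *m L \in unitmx.
  rewrite -{2}(trmxK L); apply: gram_unitmx.
  by rewrite /row_free mxrank_tr -/(row_full L).
pose G := S^T *m invmx (S *m S^T); pose H := invmx (L^T *m L) *m L^T.
have SG : S *m G = 1%:M by rewrite mulmxA mulmxV.
have HL : H *m L = 1%:M by rewrite -mulmxA mulVmx.
have XP : X *m (G *m H) = L *m H.
  by rewrite XE mulmxA -(mulmxA L) SG mulmx1.
have PX : G *m H *m X = G *m S.
  by rewrite XE mulmxA -(mulmxA G) HL mulmx1.
exists (G *m H); split.
- by rewrite XP XE mulmxA -(mulmxA L) HL mulmx1.
- by rewrite PX mulmxA -(mulmxA G) SG mulmx1.
- by rewrite XP /H !trmx_mul trmxK trmx_inv trmx_mul trmxK -mulmxA.
- by rewrite PX /G !trmx_mul trmxK trmx_inv trmx_mul trmxK -mulmxA.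
Qed.

Lemma mp_pinvP (R : realType) (m n : nat) (X : 'M[R]_(m, n)) :
  is_pinv X (mp_pinv X).
Proof. by have [P hP] := is_pinv_exists X; exact: (xgetI 0 hP). Qed.

Lemma normFZ (R : realType) (m n : nat) (a : R) (A : 'M[R]_(m, n)) :
  normF (a *: A) = `|a| * normF A.
Proof.
rewrite /normF -sqrtr_sqr -sqrtrM ?sqr_ge0//; congr Num.sqrt.
rewrite mulr_sumr; apply: eq_bigr => i _; rewrite mulr_sumr.
by apply: eq_bigr => j _; rewrite mxE exprMn.
Qed.

Lemma normr_le_normF (R : realType) (m n : nat) (A : 'M[R]_(m, n)) i j :
  `|A i j| <= normF A.
Proof.
rewrite -sqrtr_sqr; apply: ler_wsqrtr.
rewrite (bigD1 i)//= (bigD1 j)//= -addrA lerDl addr_ge0//.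
  by apply: sumr_ge0 => k _; exact: sqr_ge0.
by apply: sumr_ge0 => k _; apply: sumr_ge0 => l _; exact: sqr_ge0.
Qed.

Lemma sumr_continuous (R : realType) (T : topologicalType) (k : nat)
    (g : 'I_k -> T -> R) :
  (forall i, continuous (g i)) -> continuous (fun x => \sum_i g i x).
Proof.
by move=> cg; apply: continuous_big => // x; exact: add_continuous.
Qed.

Lemma normF_continuous (R : realType) (T : topologicalType) (m n : nat)
    (g : T -> 'M[R]_(m, n)) :
  (forall i j, continuous (fun v => g v i j)) ->
  continuous (fun v => normF (g v)).
Proof.
move=> cg v; apply: (@continuous_comp _ _ _
  (fun v => \sum_i \sum_j g v i j ^+ 2) Num.sqrt); last exact: sqrt_continuous.
apply: (@sumr_continuous R T) => i.
apply: (@sumr_continuous R T) => j {}v.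
apply: (@continuous_comp _ _ _ (fun v => g v i j) (@GRing.exp R ^~ 2%N)).
  exact: cg.
exact: exprn_continuous.
Qed.

Lemma normF_ratio_extrema (R : realType) (m n p q : nat)
    (f : {linear 'M[R]_(m, n) -> 'M[R]_(p, q)}) :
  (0 < m)%N -> (0 < n)%N ->
  (exists2 Y0, Y0 != 0 & forall Y, Y != 0 ->
     normF (f Y0) / normF Y0 <= normF (f Y) / normF Y) /\
  (exists2 Y0, Y0 != 0 & forall Y, Y != 0 ->
     normF (f Y) / normF Y <= normF (f Y0) / normF Y0).
Proof.
move=> m0 n0.
pose S := [set v : 'rV[R]_(m * n) | normF (vec_mx v) = 1].
pose g (v : 'rV[R]_(m * n)) := f (vec_mx v).
have cv i j : continuous (fun v : 'rV[R]_(m * n) => vec_mx v i j).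
  have -> : (fun v : 'rV[R]_(m * n) => vec_mx v i j) =
      (fun v : 'rV[R]_(m * n) => v ord0 (mxvec_index i j)).
    by apply/funext => v; rewrite mxE.
  exact: coord_continuous.
have cg i j : continuous (fun v => g v i j).
  have gE v : g v i j =
      \sum_k \sum_l vec_mx v k l * f (delta_mx k l) i j.
    rewrite /g {1}(matrix_sum_delta (vec_mx v)) linear_sum summxE.
    apply: eq_bigr => k _; rewrite linear_sum summxE.
    by apply: eq_bigr => l _; rewrite linearZ mxE.
  have -> : (fun v => g v i j) = (fun v : 'rV[R]_(m * n) =>
      \sum_k \sum_l vec_mx v k l * f (delta_mx k l) i j).
    exact/funext.
  apply: sumr_continuous => k; apply: sumr_continuous => l v.
  by apply: continuousM; [exact: (cv k l v)|exact: cst_continuous].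
have unit_norm (Y : 'M[R]_(m, n)) : Y != 0 -> normF ((normF Y)^-1 *: Y) = 1.
  move=> Y0; rewrite normFZ ger0_norm ?invr_ge0 ?normF_ge0//.
  by rewrite mulVf// normF_eq0.
have S0 : S !=set0.
  pose D : 'M[R]_(m, n) := const_mx 1.
  have D0 : D != 0.
    apply/eqP => /matrixP /(_ (Ordinal m0) (Ordinal n0)) /eqP.
    by rewrite !mxE oner_eq0.
  by exists (mxvec ((normF D)^-1 *: D)); rewrite /S /= mxvecK unit_norm.
have cS : compact S.
  apply: bounded_closed_compact.
    exists 1; split; first exact: num_real.
    move=> M M1 v Sv; apply: le_trans (ltW M1).
    rewrite /Num.Def.normr /= mx_normrE; apply: bigmax_le => // -[i j] _ /=.
    rewrite -[leRHS]Sv ord1 -[v]vec_mxK.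
    case/mxvec_indexP: j => k l; rewrite mxvecE vec_mxK.
    exact: normr_le_normF.
  have cN : continuous
      (fun v : 'rV[R]_(m * n) => normF (vec_mx v : 'M[R]_(m, n))).
    by apply: normF_continuous; exact: cv.
  have := proj1 (continuous_closedP _) cN _ (@closed_eq R 1).
  exact.
have cf : {within S, continuous (fun v => normF (g v))}.
  by apply: continuous_subspaceT; exact: normF_continuous.
have S_neq0 v : v \in S -> vec_mx v != 0.
  by rewrite inE /S /= -normF_eq0 => ->; exact: oner_neq0.
have ratioE v : v \in S -> normF (f (vec_mx v)) / normF (vec_mx v) =
    normF (g v).
  by rewrite inE /S /= => ->; rewrite divr1.
have ratioY Y : Y != 0 -> exists2 v, v \in S &
    normF (f Y) / normF Y = normF (g v).
  move=> Y0; exists (mxvec ((normF Y)^-1 *: Y)).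
    by rewrite inE /S /= mxvecK unit_norm.
  rewrite /g /= mxvecK linearZ normFZ ger0_norm ?invr_ge0 ?normF_ge0//.
  by rewrite mulrC.
split.
- have [c cS' hc] := compact_EVT_min S0 cS cf.
  exists (vec_mx c); first exact: S_neq0.
  by move=> Y /ratioY[v vS ->]; rewrite ratioE// hc.
- have [c cS' hc] := compact_EVT_max S0 cS cf.
  exists (vec_mx c); first exact: S_neq0.
  by move=> Y /ratioY[v vS ->]; rewrite ratioE// hc.
Qed.

Lemma norm2_max (R : realType) (m n : nat) (A : 'M[R]_(m, n)) :
  (0 < n)%N ->
  exists x : 'cV[R]_n, [/\ x != 0, norm2 A = normF (A *m x) / normF x &
    forall y : 'cV[R]_n, y != 0 -> normF (A *m y) / normF y <= norm2 A].
Proof.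
move=> n0; have [_ [x x0 hx]] := normF_ratio_extrema (mulmx A) n0 (ltn0Sn 0).
have E : norm2 A = normF (A *m x) / normF x.
  apply/eqP; rewrite eq_le; apply/andP; split.
    apply: ge_sup; first by exists (normF (A *m x) / normF x), x.
    by move=> _ [y y0 <-]; exact: hx.
  apply: ub_le_sup; last by exists x.
  by exists (normF (A *m x) / normF x) => _ [y y0 <-]; exact: hx.
by exists x; split => // y y0; rewrite E hx.
Qed.

Lemma sep_min (R : realType) (m n : nat) (A : 'M[R]_m) (B : 'M[R]_n) :
  (0 < m)%N -> (0 < n)%N ->
  exists Y : 'M[R]_(m, n),
    [/\ Y != 0, sep A B = normF (A *m Y - Y *m B) / normF Y &
      forall Z : 'M[R]_(m, n), Z != 0 ->
        sep A B <= normF (A *m Z - Z *m B) / normF Z].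
Proof.
move=> m0 n0.
pose f : 'M[R]_(m, n) -> 'M[R]_(m, n) := mulmx A \- mulmxr B.
pose F : {linear 'M[R]_(m, n) -> 'M[R]_(m, n)} := f.
have [[Y Y0 hY] _] := normF_ratio_extrema F m0 n0.
have E : sep A B = normF (A *m Y - Y *m B) / normF Y.
  apply/eqP; rewrite eq_le; apply/andP; split.
    apply: ge_inf; last by exists Y.
    by exists (normF (A *m Y - Y *m B) / normF Y) => _ [Z Z0 <-]; exact: hY.
  apply: lb_le_inf; first by exists (normF (A *m Y - Y *m B) / normF Y), Y.
  by move=> _ [Z Z0 <-]; exact: hY.
by exists Y; split => // Z Z0; rewrite E; exact: hY.
Qed.

(* Main.v *)
Require Import Defs.
From mathcomp Require Import all_boot all_order all_algebra.
From mathcomp Require Import all_classical all_reals all_analysis.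
From mathcomp Require Import complex.
From mathcomp Require Import ring lra.

Set Implicit Arguments.
Unset Strict Implicit.
Unset Printing Implicit Defensive.

Import Order.TTheory GRing.Theory Num.Theory.
Local Open Scope ring_scope.

(** The definition of [sep] gives [sep A B * normF X <= normF C], and
    [norm2 C <= (norm2 A + norm2 B) * norm2 X]; since [norm2 X <= normF X], the
    middle term is at most [1], whereas [kappa2 X >= 1] because [X X^+] fixes
    the column space of [X]. The second inequality amounts to
    [normF C <= sqrt (rank C) * norm2 C], obtained by repeatedly splitting off
    from [C] a unit vector of its row space. When [C = 0], all the terms other
    than [kappa2 X] vanish, since division by zero gives zero. *)

Lemma normF_sqr (R : realType) (m n : nat) (A : 'M[R]_(m, n)) :
  normF A ^+ 2 = \tr (A *m A^T).
Proof.
rewrite sqr_sqrtr; last by do 2![apply: sumr_ge0 => ? _]; exact: sqr_ge0.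
rewrite /mxtrace; apply: eq_bigr => i _; rewrite mxE; apply: eq_bigr => j _.
by rewrite mxE expr2.
Qed.

Lemma normF_tr (R : realType) (m n : nat) (A : 'M[R]_(m, n)) :
  normF A^T = normF A.
Proof.
rewrite /normF exchange_big; congr Num.sqrt.
by do 2![apply: eq_bigr => ? _]; rewrite mxE.
Qed.

Lemma normF0 (R : realType) (m n : nat) : normF (0 : 'M[R]_(m, n)) = 0.
Proof. by apply/eqP; rewrite normF_eq0. Qed.

Lemma normF_unit (R : realType) (m n : nat) (A : 'M[R]_(m, n)) :
  A != 0 -> normF ((normF A)^-1 *: A) = 1.
Proof.
move=> A0; rewrite normFZ ger0_norm ?invr_ge0 ?normF_ge0//.
by rewrite mulVf// normF_eq0.
Qed.

Lemma unit_mul_tr (R : realType) (n : nat) (v : 'cV[R]_n) :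
  normF v = 1 -> v^T *m v = 1%:M.
Proof.
move=> v1; rewrite [v^T *m v]mx11_scalar -trace_mx11.
by rewrite -{2}(trmxK v) -normF_sqr normF_tr v1 expr1n.
Qed.

(** Pythagoras for the trace inner product: [A *m v *m v^T] is orthogonal to its complement in [A]
    and has the same Frobenius norm as [A *m v]. *)
Lemma normF_split_unit (R : realType) (m n : nat) (A : 'M[R]_(m, n))
    (v : 'cV[R]_n) :
  normF v = 1 ->
  normF A ^+ 2 = normF (A *m v) ^+ 2 + normF (A - A *m v *m v^T) ^+ 2.
Proof.
move=> /unit_mul_tr v1; rewrite !normF_sqr linearB/= !trmx_mul !trmxK.
rewrite mulmxBl !mulmxBr !linearB/= !mulmxA -(mulmxA (A *m v) v^T v) v1 mulmx1.
ring.
Qed.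

(** Normalize [x], then drop the complement in [normF_split_unit]. For a one-row [A] this is
    Cauchy-Schwarz. *)
Lemma normF_mul_col (R : realType) (m n : nat) (A : 'M[R]_(m, n))
    (x : 'cV[R]_n) :
  normF (A *m x) <= normF A * normF x.
Proof.
have [->|x0] := eqVneq x 0; first by rewrite mulmx0 !normF0 mulr0.
have nx : 0 < normF x by rewrite lt_neqAle eq_sym normF_eq0 x0 normF_ge0.
rewrite -ler_pdivrMr// mulrC -[(normF x)^-1]ger0_norm ?invr_ge0 ?normF_ge0//.
rewrite -normFZ scalemxAr.
rewrite -(ler_pXn2r (ltn0Sn 1)) ?nnegrE ?normF_ge0//.
by rewrite [leRHS](normF_split_unit _ (normF_unit x0)) lerDl sqr_ge0.
Qed.

(** Orthogonal projection onto the complement of [v] is a contraction: [normF_split_unit] for the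
    row [x^T], keeping only the second summand. *)
Lemma normF_subproj_unit (R : realType) (n : nat) (v x : 'cV[R]_n) :
  normF v = 1 -> normF (x - v *m (v^T *m x)) <= normF x.
Proof.
move=> v1; rewrite -normF_tr linearB/= !trmx_mul trmxK -[normF x]normF_tr.
rewrite -(ler_pXn2r (ltn0Sn 1)) ?nnegrE ?normF_ge0//.
by rewrite [leRHS](normF_split_unit _ v1) lerDr sqr_ge0.
Qed.

Lemma ler_normFB_col (R : realType) (n : nat) (u v : 'cV[R]_n) :
  normF (u - v) <= normF u + normF v.
Proof.
rewrite -(ler_pXn2r (ltn0Sn 1)) ?nnegrE ?addr_ge0 ?normF_ge0//.
(* Cauchy-Schwarz, which controls the cross term of the expanded square below. *)
have cs : - \tr (u^T *m v) <= normF u * normF v.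
  apply: (@le_trans _ _ (normF (u^T *m v))).
    rewrite trace_mx11; apply: le_trans (normr_le_normF _ 0 0).
    by rewrite -normrN ler_norm.
  by rewrite -[normF u]normF_tr; exact: normF_mul_col.
have E : normF (u - v) ^+ 2 =
    normF u ^+ 2 - \tr (u^T *m v) *+ 2 + normF v ^+ 2.
  rewrite -[normF (_ - _)]normF_tr -[normF u]normF_tr -[normF v]normF_tr !normF_sqr !trmxK.
  rewrite [(u - v)^T]linearB/= mulmxBl !mulmxBr !linearB/=.
  have -> : \tr (v^T *m u) = \tr (u^T *m v).
    by rewrite -mxtrace_tr trmx_mul trmxK.
  ring.
rewrite E; nra.
Qed.

Lemma norm2_ge0 (R : realType) (m n : nat) (A : 'M[R]_(m, n)) :
  (0 < n)%N -> 0 <= norm2 A.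
Proof.
by move=> /(norm2_max A)[x [_ -> _]]; rewrite divr_ge0 ?normF_ge0.
Qed.

Lemma normF_mul_col_norm2 (R : realType) (m n : nat) (A : 'M[R]_(m, n))
    (x : 'cV[R]_n) :
  (0 < n)%N -> normF (A *m x) <= norm2 A * normF x.
Proof.
move=> n0; have [->|x0] := eqVneq x 0; first by rewrite mulmx0 !normF0 mulr0.
have nx : 0 < normF x by rewrite lt_neqAle eq_sym normF_eq0 x0 normF_ge0.
by have [_ [_ _ h]] := norm2_max A n0; rewrite -ler_pdivrMr// h.
Qed.

Lemma norm2_le (R : realType) (m n : nat) (A : 'M[R]_(m, n)) (c : R) :
  (0 < n)%N -> (forall x : 'cV[R]_n, normF (A *m x) <= c * normF x) ->
  norm2 A <= c.
Proof.
move=> n0 h; have [x [x0 -> _]] := norm2_max A n0.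
have nx : 0 < normF x by rewrite lt_neqAle eq_sym normF_eq0 x0 normF_ge0.
by rewrite ler_pdivrMr.
Qed.

Lemma norm2_le_normF (R : realType) (m n : nat) (A : 'M[R]_(m, n)) :
  (0 < n)%N -> norm2 A <= normF A.
Proof. by move=> n0; apply: norm2_le => // x; exact: normF_mul_col. Qed.

Lemma norm2_sylvester (R : realType) (m n : nat) (A : 'M[R]_m) (B : 'M[R]_n)
    (X : 'M[R]_(m, n)) :
  (0 < m)%N -> (0 < n)%N ->
  norm2 (A *m X - X *m B) <= (norm2 A + norm2 B) * norm2 X.
Proof.
move=> m0 n0; apply: norm2_le => // x; rewrite mulmxBl -!mulmxA.
apply: le_trans (ler_normFB_col _ _) _; rewrite !mulrDl; apply: lerD.
  apply: le_trans (normF_mul_col_norm2 _ _ m0) _.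
  by rewrite -mulrA ler_wpM2l ?norm2_ge0// normF_mul_col_norm2.
apply: le_trans (normF_mul_col_norm2 _ _ n0) _.
by rewrite [norm2 B * _]mulrC -mulrA ler_wpM2l ?norm2_ge0// normF_mul_col_norm2.
Qed.

Lemma kappa2_ge1 (R : realType) (m n : nat) (X : 'M[R]_(m, n)) :
  (0 < m)%N -> (0 < n)%N -> X != 0 -> 1 <= kappa2 X.
Proof.
move=> m0 n0 X0; rewrite /kappa2; have [XPX _ _ _] := mp_pinvP X.
have [j Xj] : exists j, col j X != 0.
  apply/existsP; apply: contraNT X0; rewrite negb_exists => /forallP h.
  apply/eqP/matrixP => i j; have /negPn/eqP/matrixP/(_ i 0) := h j.
  by rewrite !mxE.
have nXj : 0 < normF (col j X) by rewrite lt_neqAle eq_sym normF_eq0 Xj normF_ge0.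
rewrite -(ler_pM2r nXj) mul1r.
(* The first Penrose condition: [X *m mp_pinv X] fixes each column of [X], so its operator norm is
   at least 1. *)
have E : col j X = X *m (mp_pinv X *m col j X) by rewrite !colE !mulmxA XPX.
rewrite {1}E -mulrA; apply: le_trans (normF_mul_col_norm2 _ _ n0) _.
by rewrite ler_wpM2l ?norm2_ge0// normF_mul_col_norm2.
Qed.

(** Induction on the rank. The bound [c] is kept fixed because the deflated matrix [D] inherits it;
    each unit vector split off contributes at most [c ^+ 2]. *)
Lemma normF_le_rank (R : realType) (m n : nat) (A : 'M[R]_(m, n)) (c : R) :
  0 <= c -> (forall x : 'cV[R]_n, normF (A *m x) <= c * normF x) ->
  normF A ^+ 2 <= (\rank A)%:R * c ^+ 2.
Proof.
move=> c0; have [r] := ubnP (\rank A); elim: r A => // r IHr A Ar hA.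
have [A0|A0] := eqVneq A 0.
  by rewrite A0 normF0 expr0n mxrank0 mul0r.
have [i Ai] : exists i, row i A != 0.
  apply/existsP; apply: contraNT A0; rewrite negb_exists => /forallP h.
  by apply/eqP/row_matrixP => i; rewrite row0; apply/eqP; have /negPn := h i.
pose w := (normF (row i A))^-1 *: row i A; pose v := w^T.
have v1 : normF v = 1 by rewrite normF_tr normF_unit.
have vv := unit_mul_tr v1.
pose D := A - A *m v *m v^T.
have wA : (w <= A)%MS by rewrite scalemx_sub ?row_sub.
have DA : (D <= A)%MS by rewrite addmx_sub// eqmx_opp /v trmxK mulmx_sub.
have Dv : D *m v = 0 by rewrite mulmxBl -[A *m v *m _ *m _]mulmxA vv mulmx1 subrr.
(* With equal ranks the row spaces of [D] and [A] coincide, so [w = u *m D]; then [D *m v = 0]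
   contradicts [v^T *m v = 1]. *)
have rDA : (\rank D < \rank A)%N.
  rewrite ltn_neqAle mxrankS// andbT; apply/negP => rE.
  have /submxP[u wE] : (w <= D)%MS.
    by apply: submx_trans wA _; rewrite -(mxrank_leqif_sup DA).
  move: vv; rewrite {1}/v trmxK wE -mulmxA Dv mulmx0 => /matrixP/(_ 0 0)/eqP.
  by rewrite !mxE eq_sym oner_eq0.
(* [D] is [A] precomposed with the projection orthogonal to [v]. *)
have hD (x : 'cV[R]_n) : normF (D *m x) <= c * normF x.
  have -> : D *m x = A *m (x - v *m (v^T *m x)).
    by rewrite mulmxBl mulmxBr !mulmxA.
  by apply: le_trans (hA _) _; rewrite ler_wpM2l// normF_subproj_unit.
rewrite (normF_split_unit A v1) -/D.
have hAv : normF (A *m v) ^+ 2 <= c ^+ 2.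
  by rewrite ler_pXn2r ?nnegrE ?normF_ge0//; have := hA v; rewrite v1 mulr1.
apply: le_trans (lerD hAv (IHr D (leq_trans rDA Ar) hD)) _.
have rDA' : (\rank D)%:R + 1 <= (\rank A)%:R :> R by rewrite natr1 ler_nat.
have := sqr_ge0 c; nra.
Qed.

Theorem mainTheorem5 (R : realType) (m n : nat) (n_gt0 : (0 < n)%N)
    (le_nm : (n <= m)%N) (A : 'M[R]_m) (B : 'M[R]_n)
    (AB_disjoint : forall z : R[i],
       ~ (complex_eigenvalue A z /\ complex_eigenvalue B z))
    (C X : 'M[R]_(m, n)) (X_sol : A *m X - X *m B = C)
    (X_full : \rank X = minn m n) :
  norm2 C / (norm2 A + norm2 B) * (sep A B / normF C) <= kappa2 X
  /\ sep A B / (Num.sqrt (\rank C)%:R * (norm2 A + norm2 B))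
     <= norm2 C / (norm2 A + norm2 B) * (sep A B / normF C).
Proof.
have m_gt0 : (0 < m)%N := leq_trans n_gt0 le_nm.
(* Full rank here means rank [n], which is positive. *)
have X0 : X != 0 by rewrite -mxrank_eq0 X_full (minn_idPr le_nm) -lt0n.
have k1 := kappa2_ge1 m_gt0 n_gt0 X0.
have [C0|C0] := eqVneq C 0.
  rewrite C0 normF0 mxrank0 sqrtr0 mul0r invr0 !mulr0.
  by split=> //; exact: le_trans ler01 k1.
have nC : 0 < normF C by rewrite lt_neqAle eq_sym normF_eq0 C0 normF_ge0.
have nX : 0 < normF X by rewrite lt_neqAle eq_sym normF_eq0 X0 normF_ge0.
have s0 : 0 <= sep A B.
  have [Y [_ -> _]] := sep_min A B m_gt0 n_gt0.
  by rewrite divr_ge0 ?normF_ge0.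
have sX : sep A B * normF X <= normF C.
  have [_ [_ _ /(_ X X0)]] := sep_min A B m_gt0 n_gt0.
  by rewrite X_sol ler_pdivlMr.
have a0 := norm2_ge0 A m_gt0; have b0 := norm2_ge0 B n_gt0.
have CX := norm2_sylvester A B X m_gt0 n_gt0; rewrite X_sol in CX.
have XX := norm2_le_normF X n_gt0.
(* If the sum is zero, both quotients are zero by convention. *)
have [ab0|ab0] := eqVneq (norm2 A + norm2 B) 0.
  rewrite ab0 mulr0 invr0 !mulr0 mul0r.
  by split=> //; exact: le_trans ler01 k1.
have ab : 0 < norm2 A + norm2 B by rewrite lt_neqAle eq_sym ab0 addr_ge0.
split.
  (* The middle term is at most 1: bound [norm2 C] by [CX], then [norm2 X] by [normF X], and finish
     with [sX]. *)
  apply: le_trans k1; rewrite mulf_div ler_pdivrMr ?mulr_gt0// mul1r.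
  apply: le_trans (ler_wpM2r s0 CX) _.
  rewrite -mulrA ler_pM2l// mulrC; apply: le_trans sX.
  by rewrite ler_wpM2l.
have rC : 0 < Num.sqrt (\rank C)%:R :> R.
  by rewrite sqrtr_gt0 ltr0n lt0n mxrank_eq0.
have fC : normF C <= Num.sqrt (\rank C)%:R * norm2 C.
  rewrite -(ler_pXn2r (ltn0Sn 1)) ?nnegrE ?mulr_ge0 ?normF_ge0 ?norm2_ge0 ?sqrtr_ge0//.
  rewrite exprMn [Num.sqrt _%:R ^+ 2]sqr_sqrtr ?ler0n//.
  apply: normF_le_rank.
    exact: norm2_ge0.
  by move=> x; exact: normF_mul_col_norm2.
(* After clearing denominators, the common factors [sep A B] and [norm2 A + norm2 B] reduce the goal
   to [fC]. *)
rewrite mulf_div ler_pdivrMr ?mulr_gt0// mulrAC ler_pdivlMr ?mulr_gt0//.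
have -> : norm2 C * sep A B * (Num.sqrt (\rank C)%:R * (norm2 A + norm2 B)) =
    sep A B * ((norm2 A + norm2 B) * (Num.sqrt (\rank C)%:R * norm2 C)).
  ring.
by rewrite ler_wpM2l// ler_pM2l.
Qed.
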